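(* Let $d\ge4$ be an even integer and let $(a,b)\in\mathbb{R}^2$ satisfy $$\tfrac1{d-3}a+b>\tfrac1{d+1},\qquad a+(1+d)b\le1,\qquad(1+d)a+b\le1.$$ Let $$\rho_{a,b}=\frac{1-a-b}{d^2}I_d\otimes I_d+a|\omega_d\rangle\langle\omega_d|+\frac bd(I_d\otimes\Omega_d)F_d(I_d\otimes\Omega_d)^*.$$ Then for any unit vectors $v_1,\dots,v_m\in\mathbb{C}^d$ and any $p_0,p_1,\dots,p_m\ge0$ with $\sum_{j=0}^mp_j=1$ and $p_0>0$, the quantum state $$\rho_{AB}=p_0\rho_{a,b}+\sum_{j=1}^mp_j\,|v_j\rangle\langle v_j|\otimes|\Omega_dv_j\rangle\langle\Omega_dv_j|$$ on $\mathbb{C}^d\otimes\mathbb{C}^d$ is PPT and $\mathrm{SN}(\rho_{AB})=d/2$.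
   Context: $\Omega_d=\begin{pmatrix}0&I_{d/2}\\-I_{d/2}&0\end{pmatrix}$, $|\omega_d\rangle=\frac1{\sqrt d}\sum_{j=1}^d|jj\rangle$, $F_d=\sum_{i,j=1}^d|ij\rangle\langle ji|$. A quantum state is a positive semidefinite trace-one matrix; it is PPT if its partial transpose $(\mathrm{id}\otimes\top)(\rho)$ is positive semidefinite. The Schmidt number $\mathrm{SN}(\rho)$ is the smallest $k$ such that $\rho$ is a convex combination of pure states $|\xi\rangle\langle\xi|$ with $\xi$ of Schmidt rank at most $k$. (The stated inequalities on $(a,b)$ describe exactly those $(a,b)$ for which $\rho_{a,b}$ is a PPT state with Schmidt number larger than $d/2-1$.) *)

(* Defs.v *)
From mathcomp Require Import all_boot all_order all_algebra.
From mathcomp Require Export reals.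
From mathcomp.real_closed Require Export complex mxtens.

Set Implicit Arguments.
Unset Strict Implicit.
Unset Printing Implicit Defensive.

Import Order.TTheory GRing.Theory Num.Theory.
Local Open Scope ring_scope.
Local Open Scope sesquilinear_scope.
Local Open Scope complex_scope.

Section Defs.
Variable R : realType.
Local Notation C := R[i].

(* Vectors are columns and |u> (x) |v> lives in C^(m * n), with |i j> sitting
   at position mxtens_index (i, j) = i * n + j; the Kronecker product of
   matrices *t uses the same convention. *)
Definition ket d (i : 'I_d) : 'cV[C]_d := delta_mx i 0.

Definition tensv m n (u : 'cV[C]_m) (v : 'cV[C]_n) : 'cV[C]_(m * n) := u *t v.

Definition ketbra m n (u : 'cV[C]_m) (v : 'cV[C]_n) : 'M[C]_(m, n) :=
  u *m v ^t*.

Definition proj n (u : 'cV[C]_n) : 'M[C]_n := ketbra u u.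

Definition unit_vec n (u : 'cV[C]_n) : Prop := u ^t* *m u = 1%:M.

Definition psd n (A : 'M[C]_n) : Prop :=
  A \is hermsymmx /\ forall x : 'cV[C]_n, 0 <= (x ^t* *m A *m x) 0 0.

Definition is_state n (rho : 'M[C]_n) : Prop := psd rho /\ \tr rho = 1.

(* (id (x) T)(A), i.e. <i l|A^Gamma|k j> = <i j|A|k l> *)
Definition ptrans m n (A : 'M[C]_(m * n)) : 'M[C]_(m * n) :=
  \matrix_(p, q)
    A (mxtens_index ((mxtens_unindex p).1, (mxtens_unindex q).2))
      (mxtens_index ((mxtens_unindex q).1, (mxtens_unindex p).2)).

Definition is_PPT m n (rho : 'M[C]_(m * n)) : Prop :=
  is_state rho /\ psd (ptrans rho).

(* xi = \sum_(i, j) coefmx xi i j |i j>; the Schmidt coefficients of xi are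
   the nonzero singular values of coefmx xi, so their number is its rank. *)
Definition coefmx m n (xi : 'cV[C]_(m * n)) : 'M[C]_(m, n) :=
  \matrix_(i, j) xi (mxtens_index (i, j)) 0.

Definition schmidt_rank m n (xi : 'cV[C]_(m * n)) : nat := \rank (coefmx xi).

Definition SN_le m n (rho : 'M[C]_(m * n)) (k : nat) : Prop :=
  exists (N : nat) (w : 'I_N -> R) (xi : 'I_N -> 'cV[C]_(m * n)),
    [/\ forall s, 0 <= w s,
        \sum_s w s = 1,
        forall s, unit_vec (xi s) /\ (schmidt_rank (xi s) <= k)%N &
        rho = \sum_s (w s)%:C *: proj (xi s)].

(* SN(rho) = k *)
Definition has_SN m n (rho : 'M[C]_(m * n)) (k : nat) : Prop :=
  SN_le rho k /\ forall l, SN_le rho l -> (k <= l)%N.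

(* For even d this is the block matrix [0, 1; -1, 0]; see Omega_block. *)
Definition Omega d : 'M[C]_d :=
  \matrix_(i, j) ((j == i + d./2 :> nat)%N%:R - (i == j + d./2 :> nat)%N%:R).

Definition omega d : 'cV[C]_(d * d) :=
  ((Num.sqrt (d%:R : R))^-1)%:C *: \sum_(j < d) tensv (ket j) (ket j).

Definition flip d : 'M[C]_(d * d) :=
  \sum_(i < d) \sum_(j < d)
    ketbra (tensv (ket i) (ket j)) (tensv (ket j) (ket i)).

Definition rho_ab d (a b : R) : 'M[C]_(d * d) :=
  ((1 - a - b) / d%:R ^+ 2)%:C *: ((1%:M : 'M[C]_d) *t (1%:M : 'M[C]_d))
  + a%:C *: proj (omega d)
  + (b / d%:R)%:C *:
      ((1%:M *t Omega d) *m flip d *m (1%:M *t Omega d) ^t*).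

Lemma Omega_block k : Omega (k + k) = block_mx 0 1%:M (- 1%:M) 0.
Proof.
have hk : (k + k)./2 = k by rewrite addnn doubleK.
apply/matrixP => x y; rewrite mxE [in RHS]/block_mx.
set h := (k + k)./2; have {hk} -> : h = k := hk.
rewrite -[x]splitK -[y]splitK.
case: (split x) => i'; case: (split y) => j' /=;
  rewrite ?col_mxEu ?col_mxEd ?row_mxEl ?row_mxEr !mxE /=.
- have -> : (j' == i' + k :> nat)%N = false.
    by apply/negbTE; rewrite neq_ltn (leq_trans (ltn_ord j')) ?leq_addl.
  have -> : (i' == j' + k :> nat)%N = false.
    by apply/negbTE; rewrite neq_ltn (leq_trans (ltn_ord i')) ?leq_addl.
  by rewrite subrr.
- rewrite [(k + j')%N]addnC eqn_add2r eq_sym.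
  have -> : (i' == j' + k + k :> nat)%N = false.
    by apply/negbTE; rewrite neq_ltn (leq_trans (ltn_ord i')) ?leq_addl.
  by rewrite subr0.
- have -> : (j' == k + i' + k :> nat)%N = false.
    by apply/negbTE; rewrite neq_ltn (leq_trans (ltn_ord j')) ?leq_addl.
  by rewrite [(k + i')%N]addnC eqn_add2r sub0r.
- have e (z t : 'I_k) : (k + z == k + t + k :> nat)%N = false.
    apply/negbTE; rewrite -addnA eqn_add2l neq_ltn.
    by rewrite (leq_trans (ltn_ord z)) ?leq_addl.
  by rewrite !e subrr.
Qed.

Lemma ptrans_tens m n (A : 'M[C]_m) (B : 'M[C]_n) : ptrans (A *t B) = A *t B^T.
Proof. by apply/matrixP => p q; rewrite !mxE !mxtens_indexK. Qed.

Lemma schmidt_rank_leP m n (xi : 'cV[C]_(m * n)) k :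
  (schmidt_rank xi <= k)%N <->
  exists (x : 'I_k -> 'cV[C]_m) (y : 'I_k -> 'cV[C]_n),
    xi = \sum_s tensv (x s) (y s).
Proof.
have zz (A : 'I_1 * 'I_1) : A = (0, 0) by case: A => a c; rewrite !ord1.
split=> [le_k | [x [y ->]]].
  have [L [U eLU]] : exists (L : 'M[C]_(m, k)) (U : 'M[C]_(k, n)),
      coefmx xi = L *m U.
    exists (col_ebase (coefmx xi) *m pid_mx (\rank (coefmx xi))),
           (pid_mx (\rank (coefmx xi)) *m row_ebase (coefmx xi)).
    rewrite -[LHS]mulmx_ebase !mulmxA; congr (_ *m _).
    by rewrite -mulmxA mul_pid_mx minnn (minn_idPr le_k).
  exists (fun s => col s L), (fun s => (row s U)^T).
  apply/matrixP => p q; rewrite ord1 summxE.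
  case: (mxtens_indexP p) => i j.
  have := congr1 (fun A : 'M[C]_(m, n) => A i j) eLU; rewrite !mxE => ->.
  by apply: eq_bigr => s _; rewrite !mxE mxtens_indexK.
rewrite /schmidt_rank.
have -> : coefmx (\sum_s tensv (x s) (y s)) =
    (\matrix_(i, s) x s i 0 : 'M_(m, k)) *m (\matrix_(s, j) y s j 0).
  apply/matrixP => i j; rewrite !mxE summxE.
  by apply: eq_bigr => s _; rewrite !mxE mxtens_indexK !(zz (mxtens_unindex _)).
exact: mulmx_max_rank.
Qed.

End Defs.

(* Main.v *)
(* Write Phi for the unnormalised projection onto \sum_j |jj> and M for
   (1 (x) Omega) F (1 (x) Omega)^*, so that rho_ab is a combination of 1, Phi
   and M with M^2 = 1 and M Phi = - Phi, and let d = 2n.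
   Upper bound: in the given region rho_ab is a nonnegative combination of
   1 + Phi, 1 + M and 1 + M + Phi, and each of these is a sum of |xi><xi| with
   xi of Schmidt rank at most n.  For 1 + M these are the symmetrised product
   vectors (1 (x) Omega)(|ij> + |ji>).  For the other two, pair j with j + n:
   the vector \sum_j |jj> plus a Pauli matrix with arbitrary sign on each pair is
   a sum of n product vectors, and averaging over the signs leaves Phi plus
   diagonal terms that complete to 1 (Pauli X and Y) or to 1 + M (Pauli Z).
   PPT: partial transposition turns rho_(a,b) into a local conjugate of
   rho_(b,a), and the three nonnegativity conditions are symmetric in a and b.
   Lower bound: W = (d - 2)(1 - M) - 2 Phi is nonnegative on vectors of Schmidt
   rank less than n, because |tr B|^2 <= rank B * ||B||^2, vanishes on
   |v> (x) |Omega v>, and has a negative expectation in rho_ab. *)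
Require Import Defs.
From mathcomp Require Import all_boot all_order all_algebra.
From mathcomp Require Import ring lra.
Import Order.TTheory GRing.Theory Num.Theory.
Local Open Scope complex_scope.
Local Open Scope ring_scope.
Local Open Scope sesquilinear_scope.

Set Implicit Arguments.
Unset Strict Implicit.
Unset Printing Implicit Defensive.

(** * Adjoints and the trace-rank inequality *)

Section Adjoint.
Variable C : numClosedFieldType.

Lemma adjmxM m n p (A : 'M[C]_(m, n)) (B : 'M_(n, p)) :
  (A *m B)^t* = B^t* *m A^t*.
Proof. by rewrite trmx_mul map_mxM. Qed.

Lemma adjmxD m n (A B : 'M[C]_(m, n)) : (A + B)^t* = A^t* + B^t*.
Proof. by rewrite linearD map_mxD. Qed.

Lemma adjmxZ m n (c : C) (A : 'M[C]_(m, n)) : (c *: A)^t* = c^* *: A^t*.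
Proof. by rewrite linearZ map_mxZ. Qed.

Lemma adjmxN m n (A : 'M[C]_(m, n)) : (- A)^t* = - A^t*.
Proof. by rewrite linearN map_mxN. Qed.

Lemma adjmx1 n : (1%:M : 'M[C]_n)^t* = 1%:M.
Proof. by rewrite trmx1 map_mx1. Qed.

Lemma adjmx_sum m n (I : Type) (r : seq I) (P : pred I)
    (F : I -> 'M[C]_(m, n)) :
  (\sum_(i <- r | P i) F i)^t* = \sum_(i <- r | P i) (F i)^t*.
Proof. by rewrite !linear_sum map_mx_sum. Qed.

Lemma adjmx_tens m n p q (A : 'M[C]_(m, n)) (B : 'M[C]_(p, q)) :
  (A *t B)^t* = A^t* *t B^t*.
Proof. by rewrite trmx_tens map_mxT. Qed.

Lemma mxtrace_adj n (A : 'M[C]_n) : \tr (A^t*) = (\tr A)^*.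
Proof. by rewrite [in RHS]rmorph_sum; apply: eq_bigr => i _; rewrite !mxE. Qed.

Lemma mxtrace_adjM_sum m n (A B : 'M[C]_(m, n)) :
  \tr (A^t* *m B) = \sum_i \sum_j (A i j)^* * B i j.
Proof.
rewrite exchange_big; apply: eq_bigr => j _; rewrite mxE.
by apply: eq_bigr => i _; rewrite !mxE.
Qed.

Lemma mxtrace_adjM_ge0 m n (A : 'M[C]_(m, n)) : 0 <= \tr (A^t* *m A).
Proof.
rewrite mxtrace_adjM_sum; apply: sumr_ge0 => i _; apply: sumr_ge0 => j _.
by rewrite mulrC mul_conjC_ge0.
Qed.

Lemma mxtrace_adjM_eq0 m n (A : 'M[C]_(m, n)) :
  (\tr (A^t* *m A) == 0) = (A == 0).
Proof.
apply/eqP/eqP => [|->]; last by rewrite mulmx0 linear0.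
have h i j : 0 <= (A i j)^* * A i j by rewrite mulrC mul_conjC_ge0.
rewrite mxtrace_adjM_sum => /psumr_eq0P h0; apply/matrixP => i j; rewrite mxE.
have /h0/(_ i isT)/psumr_eq0P h1 :
    forall i, true -> 0 <= \sum_j (A i j)^* * A i j.
  by move=> i' _; apply: sumr_ge0.
by apply/eqP; rewrite -mul_conjC_eq0 mulrC; apply/eqP/h1.
Qed.

(** Gram-Schmidt on a basis of the row space of [B] gives [U] with orthonormal rows; the projection
    is [U^t* *m U], and it fixes [B = T *m U]. *)
Lemma orthoproj_row_space m n (B : 'M[C]_(m, n)) :
  exists P : 'M[C]_n,
    [/\ P^t* = P, P *m P = P, \tr P = (\rank B)%:R & B *m P = B].
Proof.
set U := schmidt (row_base B).
have UU : U *m U^t* = 1%:M by apply/unitarymxP/schmidt_unitarymx/rank_leq_col.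
have /submxP [T BT] : (B <= U)%MS.
  by rewrite /U (eqmx_schmidt_free (row_base_free B)) eq_row_base.
exists (U^t* *m U); split.
- by rewrite adjmxM trmxCK.
- by rewrite mulmxA -(mulmxA _ U) UU mulmx1.
- by rewrite mxtrace_mulC UU mxtrace1.
- have : T *m U *m (U^t* *m U) = T *m U by rewrite mulmxA -(mulmxA T) UU mulmx1.
  by rewrite -BT.
Qed.

(* Expand 0 <= ||r B - (tr B) P||^2, with P the orthogonal projection onto the
   row space of B and r = rank B = tr P. *)
Lemma mxtrace_rank_bound n (B : 'M[C]_n) :
  `|\tr B| ^+ 2 <= (\rank B)%:R * \tr (B^t* *m B).
Proof.
have [B0 | r_gt0] := posnP (\rank B).
  have/eqP -> : B == 0 by rewrite -mxrank_eq0 B0.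
  by rewrite linear0 normr0 expr0n mulmx0 linear0 mulr0.
have [P [Ph PP trP BP]] := orthoproj_row_space B.
set r : C := (\rank B)%:R in trP *; set t := \tr B.
have r0 : 0 < r by rewrite ltr0n.
have trPB : \tr (P *m B) = t by rewrite mxtrace_mulC BP.
have trBP : \tr (B^t* *m P) = t^*.
  by rewrite -trPB -mxtrace_adj adjmxM Ph.
have := mxtrace_adjM_ge0 (r *: B - t *: P).
have -> : \tr ((r *: B - t *: P)^t* *m (r *: B - t *: P)) =
          r * (r * \tr (B^t* *m B) - `|t| ^+ 2).
  rewrite adjmxD adjmxN !adjmxZ Ph (CrealP (ger0_real (ltW r0))).
  rewrite mulmxDl !mulmxDr !mulNmx !mulmxN -!scalemxAl -!scalemxAr opprK.
  rewrite !(linearD, linearN, linearZ) /= PP trP trPB trBP normCK.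
  by ring.
by rewrite pmulr_rge0 // subr_ge0.
Qed.

End Adjoint.

(** * Coefficient matrices of bipartite vectors; positive semidefinite matrices *)

Section Vectors.
Variable R : realType.
Local Notation C := R[i].

Lemma conjC_real_complex (x : R) : (x%:C)^* = x%:C.
Proof. by apply: CrealP; rewrite complex_real. Qed.

Lemma real_complexE_ge0 (z : C) :
  0 <= z -> z = (complex.Re z)%:C /\ 0 <= complex.Re z.
Proof. by move=> z0; rewrite -ler0c RRe_real ?ger0_real. Qed.

Lemma mxtens_index_sum (V : nmodType) m n (F : 'I_(m * n) -> V) :
  \sum_p F p = \sum_i \sum_j F (mxtens_index (i, j)).
Proof.
rewrite pair_bigA (reindex (@mxtens_index m n)) /=.
  by apply: eq_bigr => -[].
exists (@mxtens_unindex m n) => p _; first exact: mxtens_indexK.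
exact: mxtens_unindexK.
Qed.

Lemma coefmx_inj m n : injective (@coefmx R m n).
Proof.
move=> xi eta e; apply/matrixP => p q; rewrite ord1.
case: (mxtens_indexP p) => i j.
by have /matrixP/(_ i j) := e; rewrite !mxE.
Qed.

Lemma coefmxD m n (x y : 'cV[C]_(m * n)) : coefmx (x + y) = coefmx x + coefmx y.
Proof. by apply/matrixP => i j; rewrite !mxE. Qed.

Lemma coefmxN m n (x : 'cV[C]_(m * n)) : coefmx (- x) = - coefmx x.
Proof. by apply/matrixP => i j; rewrite !mxE. Qed.

Lemma coefmxZ m n c (x : 'cV[C]_(m * n)) : coefmx (c *: x) = c *: coefmx x.
Proof. by apply/matrixP => i j; rewrite !mxE. Qed.

Lemma coefmx0 m n : coefmx (0 : 'cV[C]_(m * n)) = 0.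
Proof. by apply/matrixP => i j; rewrite !mxE. Qed.

Lemma coefmx_sum m n (I : Type) (r : seq I) (P : pred I)
    (F : I -> 'cV[C]_(m * n)) :
  coefmx (\sum_(i <- r | P i) F i) = \sum_(i <- r | P i) coefmx (F i).
Proof.
exact: (big_morph (@coefmx R m n) (@coefmxD m n) (@coefmx0 m n)).
Qed.

Lemma coefmx_tensv m n (u : 'cV[C]_m) (v : 'cV[C]_n) :
  coefmx (tensv u v) = u *m v^T.
Proof.
by apply/matrixP => i j; rewrite !mxE mxtens_indexK big_ord1 !mxE !ord1.
Qed.

Lemma tens_mul_tensv m n (A : 'M[C]_m) (B : 'M[C]_n) u v :
  (A *t B) *m tensv u v = tensv (A *m u) (B *m v).
(* The column count [1 * 1] is only convertible to [1], hence the explicit arguments in place of a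
   rewrite. *)
Proof. exact: (tensmx_mul A B u v). Qed.

(** With this, operator identities and Schmidt rank bounds reduce to matrix algebra on coefficient
    matrices. *)
Lemma coefmx_tens_mul m n (A : 'M[C]_m) (B : 'M[C]_n) (xi : 'cV[C]_(m * n)) :
  coefmx ((A *t B) *m xi) = A *m coefmx xi *m B^T.
Proof.
apply/matrixP => i j; rewrite !mxE mxtens_index_sum exchange_big /=.
apply: eq_bigr => l _; rewrite !mxE big_distrl; apply: eq_bigr => k _ /=.
by rewrite !mxE !mxtens_indexK /= mulrAC.
Qed.

Lemma inner_coefmx m n (xi eta : 'cV[C]_(m * n)) :
  (xi^t* *m eta) 0 0 = \tr ((coefmx xi)^t* *m coefmx eta).
Proof.
rewrite mxtrace_adjM_sum mxE mxtens_index_sum.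
by apply: eq_bigr => i _; apply: eq_bigr => j _; rewrite !mxE.
Qed.

Lemma mxtrace_proj n (A : 'M[C]_n) xi :
  \tr (A *m proj xi) = (xi^t* *m A *m xi) 0 0.
Proof. by rewrite /proj /ketbra mulmxA mxtrace_mulC mulmxA trace_mx11. Qed.

Lemma projZ n c (x : 'cV[C]_n) : proj (c *: x) = (c * c^*) *: proj x.
Proof. by rewrite /proj /ketbra adjmxZ -scalemxAl -scalemxAr scalerA. Qed.

Lemma mul_proj_adj m n (A : 'M[C]_(m, n)) x :
  A *m proj x *m A^t* = proj (A *m x).
Proof. by rewrite /proj /ketbra adjmxM !mulmxA. Qed.

Lemma adjmx_tensv m n (u : 'cV[C]_m) (v : 'cV[C]_n) :
  (tensv u v)^t* = u^t* *t v^t*.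
Proof. exact: (adjmx_tens u v). Qed.

Lemma proj_tensv m n (u : 'cV[C]_m) (v : 'cV[C]_n) :
  proj (tensv u v) = proj u *t proj v.
Proof.
rewrite /proj /ketbra adjmx_tensv; exact: (tensmx_mul u v (u^t*) (v^t*)).
Qed.

Lemma proj_parallelogram n (x y : 'cV[C]_n) :
  proj (x + y) + proj (x - y) = 2%:R *: (proj x + proj y).
Proof.
rewrite /proj /ketbra !adjmxD adjmxN !mulmxDl !mulmxDr !mulNmx !mulmxN.
rewrite scaler_nat mulr2n; apply/matrixP => i j; rewrite !mxE; ring.
Qed.

Lemma unit_vecE n (x : 'cV[C]_n) : unit_vec x <-> (x^t* *m x) 0 0 = 1.
Proof.
split=> [-> | h]; first by rewrite mxE.
by rewrite /unit_vec [LHS]mx11_scalar h.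
Qed.

Lemma unit_tensv m n (u : 'cV[C]_m) (v : 'cV[C]_n) :
  unit_vec u -> unit_vec v -> unit_vec (tensv u v).
Proof.
move=> hu hv; rewrite /unit_vec adjmx_tensv.
transitivity ((u^t* *m u) *t (v^t* *m v) : 'M[C]_1).
  exact: (tensmx_mul (u^t*) (v^t*) u v).
rewrite hu hv.
have zz (A : 'I_1 * 'I_1) : A = (0, 0) by case: A => a c; rewrite !ord1.
by apply/matrixP => i j; rewrite !mxE !(zz (mxtens_unindex _)) !ord1 mulr1.
Qed.

Lemma psdD n (A B : 'M[C]_n) : psd A -> psd B -> psd (A + B).
Proof.
case=> /is_hermitianmxP hA pA [/is_hermitianmxP hB pB]; split.
  (* Hermitian symmetry carries a sign [(-1) ^+ false], which [expr0] and [scale1r] remove. *)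
  apply/is_hermitianmxP; move: hA hB; rewrite !expr0 !scale1r adjmxD.
  by move=> <- <-.
by move=> x; rewrite mulmxDr mulmxDl mxE addr_ge0.
Qed.

Lemma psdZ n (c : R) (A : 'M[C]_n) : 0 <= c -> psd A -> psd (c%:C *: A).
Proof.
move=> c0 [/is_hermitianmxP hA pA]; split.
  apply/is_hermitianmxP; move: hA; rewrite !expr0 !scale1r adjmxZ.
  by rewrite conjC_real_complex => <-.
by move=> x; rewrite -scalemxAr -scalemxAl mxE mulr_ge0 ?ler0c.
Qed.

Lemma psd0 n : psd (0 : 'M[C]_n).
Proof.
split; first by apply/is_hermitianmxP; rewrite trmx0 map_mx0 scaler0.
by move=> x; rewrite mulmx0 mul0mx mxE.
Qed.

Lemma psd_conj m n (B : 'M[C]_(m, n)) (A : 'M[C]_n) :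
  psd A -> psd (B *m A *m B^t*).
Proof.
case=> /is_hermitianmxP hA pA; split.
  apply/is_hermitianmxP; move: hA; rewrite !expr0 !scale1r.
  by rewrite !adjmxM trmxCK mulmxA => <-.
move=> x; have := pA (B^t* *m x).
by rewrite adjmxM trmxCK !mulmxA.
Qed.

Lemma psd_proj n (x : 'cV[C]_n) : psd (proj x).
Proof.
have -> : proj x = x *m 1%:M *m x^t* by rewrite mulmx1.
apply: psd_conj; split.
  by apply/is_hermitianmxP; rewrite expr0 scale1r adjmx1.
move=> y; rewrite mulmx1 -trace_mx11; exact: mxtrace_adjM_ge0.
Qed.

Lemma psd_sum n (I : Type) (r : seq I) (P : pred I) (F : I -> 'M[C]_n) :
  (forall i, P i -> psd (F i)) -> psd (\sum_(i <- r | P i) F i).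
Proof. by move=> h; elim/big_ind: _ => //; [exact: psd0 | exact: psdD]. Qed.

End Vectors.

(** * Sums of projections of bounded Schmidt rank *)

Section SchmidtCone.
Variable R : realType.
Local Notation C := R[i].

Lemma schmidt_rankD m n (x y : 'cV[C]_(m * n)) :
  (schmidt_rank (x + y) <= schmidt_rank x + schmidt_rank y)%N.
Proof. by rewrite /schmidt_rank coefmxD mxrank_add. Qed.

Lemma schmidt_rankZ m n c (x : 'cV[C]_(m * n)) :
  (schmidt_rank (c *: x) <= schmidt_rank x)%N.
Proof. by rewrite /schmidt_rank coefmxZ mxrankS // scalemx_sub. Qed.

Lemma schmidt_rank_tensv m n (u : 'cV[C]_m) (v : 'cV[C]_n) :
  (schmidt_rank (tensv u v) <= 1)%N.
Proof. by rewrite /schmidt_rank coefmx_tensv mulmx_max_rank. Qed.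

Lemma schmidt_rank_tens_mul m n (A : 'M[C]_m) (B : 'M[C]_n) x :
  (schmidt_rank ((A *t B) *m x) <= schmidt_rank x)%N.
Proof.
rewrite /schmidt_rank coefmx_tens_mul.
exact: leq_trans (mxrankM_maxl _ _) (mxrankM_maxr _ _).
Qed.

Lemma schmidt_rank0 m n : schmidt_rank (0 : 'cV[C]_(m * n)) = 0%N.
Proof. by rewrite /schmidt_rank coefmx0 mxrank0. Qed.

(** The unnormalised form of [SN_le]: dropping the condition on the sum of weights makes it a convex
    cone, and the list-like shape avoids reindexing finite families. *)
Inductive SNcone m n (k : nat) : 'M[C]_(m * n) -> Prop :=
| SNcone0 : SNcone k 0
| SNcone_cons c xi A : 0 <= c -> unit_vec xi -> (schmidt_rank xi <= k)%N ->
    SNcone k A -> SNcone k (c%:C *: proj xi + A).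

Lemma SNconeD m n k (A B : 'M[C]_(m * n)) :
  SNcone k A -> SNcone k B -> SNcone k (A + B).
Proof.
move=> hA hB; elim: hA => [|c xi A' c0 u s _ ih]; first by rewrite add0r.
by rewrite -addrA; apply: SNcone_cons.
Qed.

Lemma SNconeZ m n k c (A : 'M[C]_(m * n)) :
  0 <= c -> SNcone k A -> SNcone k (c%:C *: A).
Proof.
move=> c0; elim=> [|a xi A' a0 u s _ ih].
  by rewrite scaler0; exact: SNcone0.
rewrite scalerDr scalerA -rmorphM; apply: SNcone_cons => //.
exact: mulr_ge0.
Qed.

Lemma SNcone_sum m n k (I : Type) (r : seq I) (P : pred I)
    (F : I -> 'M[C]_(m * n)) :
  (forall i, P i -> SNcone k (F i)) -> SNcone k (\sum_(i <- r | P i) F i).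
Proof.
by move=> h; elim/big_ind: _ => //; [exact: SNcone0 | exact: SNconeD].
Qed.

Lemma SNcone_proj m n k (x : 'cV[C]_(m * n)) :
  (schmidt_rank x <= k)%N -> SNcone k (proj x).
Proof.
move=> sx; pose c := complex.Re ((x^t* *m x) 0 0).
have [cE c0] : (x^t* *m x) 0 0 = c%:C /\ 0 <= c.
  by apply: real_complexE_ge0; rewrite -trace_mx11 mxtrace_adjM_ge0.
(* The zero vector cannot be normalised; its projection is the empty sum. *)
have [c_0 | c_neq0] := eqVneq c 0.
  suff -> : x = 0 by rewrite /proj /ketbra mul0mx; exact: SNcone0.
  apply/eqP; rewrite -mxtrace_adjM_eq0 trace_mx11 cE c_0; exact: eqxx.
have s_neq0 : Num.sqrt c != 0 by rewrite sqrtr_eq0 -ltNge lt_def c_neq0.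
have scE : (Num.sqrt c)^-1 * (Num.sqrt c)^-1 = c^-1.
  by rewrite -invfM -expr2 sqr_sqrtr.
pose y := (Num.sqrt c)^-1%:C *: x.
have -> : proj x = c%:C *: proj y + 0.
  rewrite addr0 projZ conjC_real_complex -rmorphM scE scalerA -rmorphM.
  by rewrite mulfV // scale1r.
apply: SNcone_cons => //; last exact: SNcone0.
  apply/unit_vecE; rewrite /y adjmxZ -scalemxAl -scalemxAr scalerA mxE cE.
  by rewrite conjC_real_complex -!rmorphM scE mulVf.
exact: leq_trans (schmidt_rankZ _ _) sx.
Qed.

Lemma SNcone_psd m n k (A : 'M[C]_(m * n)) : SNcone k A -> psd A.
Proof.
elim=> [|c xi A' c0 _ _ _ ih]; first exact: psd0.
by apply: psdD => //; apply: psdZ => //; exact: psd_proj.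
Qed.

(** Projections onto unit vectors have trace one, so the weights sum to the trace of [A]. *)
Lemma SNcone_SN_le m n k (A : 'M[C]_(m * n)) :
  SNcone k A -> \tr A = 1 -> SN_le A k.
Proof.
move=> hA trA.
have [N [w [xi [w0 hxi AE]]]] :
    exists N (w : 'I_N -> R) (xi : 'I_N -> 'cV[C]_(m * n)),
    [/\ forall s, 0 <= w s,
        forall s, unit_vec (xi s) /\ (schmidt_rank (xi s) <= k)%N &
        A = \sum_s (w s)%:C *: proj (xi s)].
  elim: hA {trA} => [|c x B c0 ux sx _ [N [w [xi [w0 hxi BE]]]]].
    exists 0%N, (fun=> 0), (fun=> 0); split; [by case|by case|].
    by rewrite big_ord0.
  exists N.+1, (fun s => if unlift ord0 s is Some t then w t else c),
    (fun s => if unlift ord0 s is Some t then xi t else x); split.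
  - by move=> s; case: unliftP.
  - by move=> s; case: unliftP.
  - rewrite big_ord_recl unlift_none BE; congr (_ + _).
    by apply: eq_bigr => s _; rewrite liftK.
exists N, w, xi; split=> //.
apply: (@complexI R); rewrite -[RHS]trA AE linear_sum rmorph_sum.
apply: eq_bigr => s _ /=; rewrite linearZ /=.
have [/unit_vecE us _] := hxi s.
by rewrite -[proj _]mul1mx mxtrace_proj mulmx1 us mulr1.
Qed.

(* Averages over independent signs: expanding the mean of
   proj (z + \sum_j (x_j +- y_j)), all cross terms of the y_j cancel. *)
Lemma SNcone_sign_average m n k (I : Type) (r : seq I)
    (x y : I -> 'cV[C]_(m * n)) (z : 'cV[C]_(m * n)) :
  (forall i, schmidt_rank (x i + y i) <= 1)%N ->
  (forall i, schmidt_rank (x i - y i) <= 1)%N ->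
  (schmidt_rank z + size r <= k)%N ->
  SNcone k (proj (z + \sum_(i <- r) x i) + \sum_(i <- r) proj (y i)).
Proof.
move=> hp hm; elim: r z => [|i r ih] z hz.
  rewrite !big_nil !addr0; apply: SNcone_proj.
  by rewrite -[schmidt_rank z]addn0.
(* Moving a vector of Schmidt rank at most one into [z] costs one unit of rank, paid for by the
   shorter list. *)
have step (t : 'cV_(m * n)) : (schmidt_rank t <= 1)%N ->
    SNcone k (proj (z + t + \sum_(j <- r) x j) + \sum_(j <- r) proj (y j)).
  move=> ht; apply: ih; apply: leq_trans hz.
  rewrite /= addnS -addSn leq_add2r -[(schmidt_rank z).+1]addn1.
  exact: leq_trans (schmidt_rankD _ _) (leq_add (leqnn _) ht).
rewrite !big_cons; move: step.
set s := \sum_(j <- r) x j; set T := \sum_(j <- r) proj (y j) => step.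
(* Averaging over the sign of [y i] is the parallelogram identity. *)
have -> : proj (z + (x i + s)) + (proj (y i) + T) =
    (2^-1 : R)%:C *: ((proj (z + (x i + y i) + s) + T)
                      + (proj (z + (x i - y i) + s) + T)).
  have -> : z + (x i + y i) + s = z + (x i + s) + y i.
    by apply/matrixP => p q; rewrite !mxE; ring.
  have -> : z + (x i - y i) + s = z + (x i + s) - y i.
    by apply/matrixP => p q; rewrite !mxE; ring.
  rewrite addrACA proj_parallelogram -mulr2n -[T *+ 2]scaler_nat.
  rewrite -scalerDr scalerA.
  rewrite -(rmorph_nat (real_complex R)) -rmorphM mulVf ?pnatr_eq0 // scale1r.
  by rewrite addrA.
by apply: SNconeZ; [rewrite invr_ge0 ler0n | apply: SNconeD; apply: step].
Qed.

End SchmidtCone.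

(** * The operators flip, Omega and their twist *)

Section SymplecticStates.
Variable R : realType.
Local Notation C := R[i].
Local Notation ket2 i j := (tensv (ket R i) (ket R j)).

(** Used with [coefmx_inj] to prove operator identities by their action on coefficient matrices. *)
Lemma mulmx_cV_ext m n (A B : 'M[C]_(m, n)) :
  (forall x : 'cV[C]_n, A *m x = B *m x) -> A = B.
Proof.
move=> h; apply/matrixP => i j.
by have /colP/(_ i) := h (delta_mx j 0); rewrite -!colE !mxE.
Qed.

Lemma coefmx_ket2 m n (i : 'I_m) (j : 'I_n) : coefmx (ket2 i j) = delta_mx i j.
Proof. by rewrite coefmx_tensv /ket trmx_delta mul_delta_mx. Qed.

Lemma ket2_inner m n (i : 'I_m) (j : 'I_n) (x : 'cV[C]_(m * n)) :
  ((ket2 i j)^t* *m x) 0 0 = coefmx x i j.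
Proof.
rewrite inner_coefmx mxtrace_adjM_sum coefmx_ket2 (bigD1 i) //= (bigD1 j) //=.
rewrite mxE !eqxx conjC1 mul1r !big1 ?addr0 // => [k | l] /negbTE ne.
  by apply: big1 => l _; rewrite mxE ne conjC0 mul0r.
by rewrite mxE ne andbF conjC0 mul0r.
Qed.

Lemma ketbra_mul m n (u : 'cV[C]_m) (v x : 'cV[C]_n) :
  ketbra u v *m x = (v^t* *m x) 0 0 *: u.
Proof.
rewrite /ketbra -mulmxA; set s := v^t* *m x.
by rewrite {1}[s]mx11_scalar mul_mx_scalar.
Qed.

Lemma sum_proj_ket2 m n :
  \sum_(i < m) \sum_(j < n) proj (ket2 i j) = 1%:M.
Proof.
apply: mulmx_cV_ext => x; apply: coefmx_inj.
rewrite mul1mx mulmx_suml coefmx_sum [RHS]matrix_sum_delta.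
apply: eq_bigr => i _.
rewrite mulmx_suml coefmx_sum; apply: eq_bigr => j _.
by rewrite ketbra_mul ket2_inner coefmxZ coefmx_ket2.
Qed.

Lemma coefmx_flip d (x : 'cV[C]_(d * d)) :
  coefmx (flip R d *m x) = (coefmx x)^T.
Proof.
rewrite [RHS]matrix_sum_delta mulmx_suml coefmx_sum; apply: eq_bigr => i _.
rewrite mulmx_suml coefmx_sum; apply: eq_bigr => j _.
by rewrite ketbra_mul ket2_inner coefmxZ coefmx_ket2 [_^T _ _]mxE.
Qed.

Lemma flip_tensv d (u v : 'cV[C]_d) : flip R d *m tensv u v = tensv v u.
Proof.
by apply: coefmx_inj; rewrite coefmx_flip !coefmx_tensv trmx_mul trmxK.
Qed.

Lemma flip_adj d : (flip R d)^t* = flip R d.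
Proof.
rewrite /flip adjmx_sum exchange_big; apply: eq_bigr => i _.
rewrite adjmx_sum; apply: eq_bigr => j _.
by rewrite /ketbra adjmxM trmxCK.
Qed.

Lemma flipK d : flip R d *m flip R d = 1%:M.
Proof.
apply: mulmx_cV_ext => x; apply: coefmx_inj.
by rewrite -mulmxA !coefmx_flip trmxK mul1mx.
Qed.

Lemma tens1mx1 m n : (1%:M : 'M[C]_m) *t (1%:M : 'M[C]_n) = 1%:M.
Proof.
apply: mulmx_cV_ext => x; apply: coefmx_inj.
by rewrite coefmx_tens_mul trmx1 mulmx1 !mul1mx.
Qed.

(** Each projection expands into two diagonal terms, which sum to the identity, and two cross terms,
    which sum to [flip]. *)
Lemma sum_sym_ket2 d :
  \sum_(i < d) \sum_(j < d) proj (ket2 i j + ket2 j i) =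
  2%:R *: (1%:M + flip R d).
Proof.
transitivity (\sum_(i < d) \sum_(j < d) (proj (ket2 i j)
   + ketbra (ket2 i j) (ket2 j i) + ketbra (ket2 j i) (ket2 i j)
   + proj (ket2 j i))).
  apply: eq_bigr => i _; apply: eq_bigr => j _.
  by rewrite /proj /ketbra adjmxD mulmxDl !mulmxDr !addrA.
under eq_bigr => i _ do rewrite !big_split /=.
rewrite !big_split /= sum_proj_ket2 -/(flip R d).
rewrite [X in _ + X + _]exchange_big -/(flip R d) [X in _ + X]exchange_big.
rewrite sum_proj_ket2 scaler_nat mulr2n /= -!addrA; congr (_ + _).
by rewrite addrC addrA.
Qed.

(** The maximally entangled vector, left unnormalised so that its coefficient matrix is the
    identity. *)
Definition maxent d : 'cV[C]_(d * d) := \sum_(j < d) ket2 j j.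

Lemma coefmx_maxent d : coefmx (maxent d) = 1%:M.
Proof.
rewrite coefmx_sum [RHS]matrix_sum_delta; apply: eq_bigr => i _.
rewrite (bigD1 i) //= big1 ?addr0 => [|j /negbTE nj].
  by rewrite coefmx_ket2 mxE eqxx scale1r.
by rewrite mxE eq_sym nj scale0r.
Qed.

Lemma proj_omega d : proj (omega R d) = (d%:R^-1)%:C *: proj (maxent d).
Proof.
by rewrite /omega projZ conjC_real_complex -rmorphM -invfM -expr2 sqr_sqrtr.
Qed.

Lemma trmx_Omega d : (Omega R d)^T = - Omega R d.
Proof. by apply/matrixP => i j; rewrite !mxE opprB. Qed.

Lemma conj_Omega d : map_mx Num.conj (Omega R d) = Omega R d.
Proof. by apply/matrixP => i j; rewrite !mxE rmorphB /= !conjC_nat. Qed.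

Lemma adj_Omega d : (Omega R d)^t* = - Omega R d.
Proof. by rewrite trmx_Omega map_mxN conj_Omega. Qed.

Lemma Omega_sqr n : Omega R (n + n) *m Omega R (n + n) = - 1%:M.
Proof.
rewrite Omega_block mulmx_block !mul0mx !mulmx0 !mul1mx !mulmx1 !addr0 !add0r.
by rewrite scalar_mx_block opp_block_mx oppr0.
Qed.

Lemma Omega_ket_lshift n (j : 'I_n) :
  Omega R (n + n) *m ket R (lshift n j) = - ket R (rshift n j).
Proof.
rewrite /ket -colE; apply/matrixP => x q; rewrite !mxE ord1 andbT.
set h := (n + n)./2; have -> : h = n by rewrite /h addnn doubleK.
rewrite -val_eqE /= ltn_eqF ?sub0r; first by rewrite addnC.
exact: leq_trans (ltn_ord j) (leq_addl _ _).
Qed.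

Lemma Omega_ket_rshift n (j : 'I_n) :
  Omega R (n + n) *m ket R (rshift n j) = ket R (lshift n j).
Proof.
apply: oppr_inj; rewrite -mulmxN -Omega_ket_lshift mulmxA Omega_sqr.
by rewrite mulNmx mul1mx.
Qed.

Definition idOmega d : 'M[C]_(d * d) := 1%:M *t Omega R d.

Definition sflip d : 'M[C]_(d * d) := idOmega d *m flip R d *m (idOmega d)^t*.

Lemma adj_idOmega d : (idOmega d)^t* = 1%:M *t (- Omega R d).
Proof. by rewrite /idOmega adjmx_tens adjmx1 adj_Omega. Qed.

Lemma idOmega_unitary n : idOmega (n + n) *m (idOmega (n + n))^t* = 1%:M.
Proof.
rewrite adj_idOmega /idOmega tensmx_mul mulmxN Omega_sqr opprK mulmx1.
exact: tens1mx1.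
Qed.

Lemma idOmega_unitaryV n : (idOmega (n + n))^t* *m idOmega (n + n) = 1%:M.
Proof. exact: mulmx1C (idOmega_unitary n). Qed.

(** For even [d] this is minus the symplectic transpose of the coefficient matrix, so the vectors
    fixed by [sflip] correspond to the symplectic Lie algebra. *)
Lemma coefmx_sflip d (x : 'cV[C]_(d * d)) :
  coefmx (sflip d *m x) = Omega R d *m (coefmx x)^T *m Omega R d.
Proof.
rewrite /sflip adj_idOmega /idOmega -!mulmxA.
rewrite coefmx_tens_mul coefmx_flip coefmx_tens_mul.
rewrite !mul1mx linearN /= trmx_Omega opprK trmx_mul trmx_Omega.
by rewrite !mulNmx mulmxN opprK mulmxA.
Qed.

Lemma sflip_maxent n : sflip (n + n) *m maxent (n + n) = - maxent (n + n).
Proof.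
apply: coefmx_inj.
by rewrite coefmx_sflip coefmxN coefmx_maxent trmx1 mulmx1 Omega_sqr.
Qed.

Lemma sflip_adj d : (sflip d)^t* = sflip d.
Proof. by rewrite /sflip !adjmxM trmxCK flip_adj mulmxA. Qed.

Lemma sflipK n : sflip (n + n) *m sflip (n + n) = 1%:M.
Proof.
rewrite /sflip -!mulmxA [_^t* *m (idOmega _ *m _)]mulmxA.
rewrite idOmega_unitaryV mul1mx.
by rewrite (mulmxA (flip _ _)) flipK mul1mx idOmega_unitary.
Qed.

(** Undoing [Omega] on the second factor leaves the product of [v] with itself, which [flip]
    fixes. *)
Lemma sflip_tensv_Omega n (v : 'cV[C]_(n + n)) :
  sflip (n + n) *m tensv v (Omega R _ *m v) = tensv v (Omega R _ *m v).
Proof.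
rewrite /sflip adj_idOmega /idOmega -!mulmxA !tens_mul_tensv.
rewrite [- _ *m _]mulmxA mulNmx Omega_sqr opprK !mul1mx flip_tensv.
by rewrite tens_mul_tensv mul1mx.
Qed.

Lemma sum_sym_idOmega n :
  \sum_(i < n + n) \sum_(j < n + n)
     proj (idOmega (n + n) *m (ket2 i j + ket2 j i)) =
  2%:R *: (1%:M + sflip (n + n)).
Proof.
transitivity (idOmega (n + n) *m (\sum_(i < n + n) \sum_(j < n + n)
    proj (ket2 i j + ket2 j i)) *m (idOmega (n + n))^t*).
  rewrite mulmx_sumr mulmx_suml; apply: eq_bigr => i _.
  rewrite mulmx_sumr mulmx_suml; apply: eq_bigr => j _.
  by rewrite mul_proj_adj.
rewrite sum_sym_ket2 -scalemxAr -scalemxAl mulmxDr mulmxDl mulmx1.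
by rewrite idOmega_unitary.
Qed.

End SymplecticStates.

(** * Decompositions into vectors of Schmidt rank at most d/2 *)

Section ConeMembership.
Variable R : realType.
Local Notation C := R[i].
Local Notation ket2 i j := (tensv (ket R i) (ket R j)).

Lemma sum_halves (V : nmodType) n (F : 'I_(n + n) -> V) :
  \sum_i F i = \sum_(j < n) (F (lshift n j) + F (rshift n j)).
Proof. by rewrite big_split_ord big_split. Qed.

Lemma maxent_halves n :
  maxent R (n + n) = \sum_(j < n)
    (ket2 (lshift n j) (lshift n j) + ket2 (rshift n j) (rshift n j)).
Proof. exact: sum_halves. Qed.

(** Each pair j, j + n contributes a block of Schmidt rank two to [maxent]; the correction [y j],
    with either sign, must lower it to a product vector. *)
Lemma SNcone_maxent_signs n (y : 'I_n -> 'cV[C]_((n + n) * (n + n))) :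
  (forall j, exists u v, ket2 (lshift n j) (lshift n j) +
    ket2 (rshift n j) (rshift n j) + y j = tensv u v) ->
  (forall j, exists u v, ket2 (lshift n j) (lshift n j) +
    ket2 (rshift n j) (rshift n j) - y j = tensv u v) ->
  SNcone n (proj (maxent R (n + n)) + \sum_(j < n) proj (y j)).
Proof.
move=> hp hm; rewrite -[maxent _ _]add0r maxent_halves.
apply: SNcone_sign_average => [j|j|].
- by have [u [v ->]] := hp j; exact: schmidt_rank_tensv.
- by have [u [v ->]] := hm j; exact: schmidt_rank_tensv.
- by rewrite schmidt_rank0 add0n /index_enum unlock -enumT size_enum_ord.
Qed.

Lemma SNcone_maxent_diag n :
  SNcone n (proj (maxent R (n + n)) + \sum_(j < n)
    proj (ket2 (lshift n j) (lshift n j) - ket2 (rshift n j) (rshift n j))).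
Proof.
apply: SNcone_maxent_signs => j.
  exists (2%:R *: ket R (lshift n j)), (ket R (lshift n j)).
  by apply/matrixP => p q; rewrite !mxE; ring.
exists (2%:R *: ket R (rshift n j)), (ket R (rshift n j)).
by apply/matrixP => p q; rewrite !mxE; ring.
Qed.

(** The mean of the decompositions by Pauli X and Pauli Y: the parallelogram identity turns the
    symmetric and antisymmetric corrections into product projections. *)
Lemma SNcone_maxent_offdiag n :
  SNcone n (proj (maxent R (n + n)) + \sum_(j < n)
    (proj (ket2 (lshift n j) (rshift n j))
     + proj (ket2 (rshift n j) (lshift n j)))).
Proof.
pose l := @lshift n n; pose r := @rshift n n.
have hx : SNcone n (proj (maxent R (n + n)) +
    \sum_(j < n) proj (ket2 (l j) (r j) + ket2 (r j) (l j))).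
  apply: SNcone_maxent_signs => j.
    exists (ket R (l j) + ket R (r j)), (ket R (l j) + ket R (r j)).
    by apply/matrixP => p q; rewrite !mxE; ring.
  exists (ket R (l j) - ket R (r j)), (ket R (l j) - ket R (r j)).
  by apply/matrixP => p q; rewrite !mxE; ring.
(* The factor ['i] makes the block determinant [1 + 'i ^+ 2] vanish, and the projection does not see
   it. *)
have hy : SNcone n (proj (maxent R (n + n)) +
    \sum_(j < n) proj ('i *: (ket2 (l j) (r j) - ket2 (r j) (l j)))).
  apply: SNcone_maxent_signs => j.
    exists (ket R (l j) - 'i *: ket R (r j)), (ket R (l j) + 'i *: ket R (r j)).
    by apply/matrixP => p q; rewrite !mxE; ring: (@sqrCi C).
  exists (ket R (l j) + 'i *: ket R (r j)), (ket R (l j) - 'i *: ket R (r j)).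
  by apply/matrixP => p q; rewrite !mxE; ring: (@sqrCi C).
have h2 : 0 <= 2^-1 :> R by rewrite invr_ge0.
have := SNconeZ h2 (SNconeD hx hy); congr SNcone.
rewrite addrACA -big_split /=.
under eq_bigr => j _ do
  rewrite projZ -normCK normCi expr1n scale1r proj_parallelogram.
rewrite -scaler_sumr -mulr2n -[proj _ *+ 2]scaler_nat -scalerDr scalerA.
by rewrite -(rmorph_nat (real_complex R)) -rmorphM mulVf ?pnatr_eq0 // scale1r.
Qed.

Definition partner n (i : 'I_(n + n)) : 'I_(n + n) :=
  match split i with inl j => rshift n j | inr j => lshift n j end.

Lemma partner_lshift n (j : 'I_n) : partner (lshift n j) = rshift n j.
Proof. by rewrite /partner -[lshift n j]/(unsplit (inl j)) unsplitK. Qed.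

Lemma partner_rshift n (j : 'I_n) : partner (rshift n j) = lshift n j.
Proof. by rewrite /partner -[rshift n j]/(unsplit (inr j)) unsplitK. Qed.

(** Isolates the index pairs to be merged with [maxent]; the remaining ones are handled one at a
    time. *)
Lemma sum_partner (V : nmodType) n (F : 'I_(n + n) -> 'I_(n + n) -> V) :
  \sum_i \sum_j F i j =
  \sum_(j < n) (F (lshift n j) (rshift n j) + F (rshift n j) (lshift n j)) +
  \sum_i \sum_(j | j != partner i) F i j.
Proof.
transitivity (\sum_i (F i (partner i) + \sum_(j | j != partner i) F i j)).
  by apply: eq_bigr => i _; rewrite (bigD1 (partner i)).
rewrite big_split sum_halves /=; congr (_ + _).
by apply: eq_bigr => j _; rewrite partner_lshift partner_rshift.
Qed.

(** In the product basis expansion of the identity, the partner terms complete [proj maxent]; the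
    others are already product projections. *)
Lemma SNcone_isotropic n : (0 < n)%N ->
  SNcone n (1%:M + proj (maxent R (n + n))).
Proof.
move=> n0; rewrite -sum_proj_ket2 sum_partner addrC addrA.
apply: SNconeD; first exact: SNcone_maxent_offdiag.
apply: SNcone_sum => i _; apply: SNcone_sum => j _; apply: SNcone_proj.
exact: leq_trans (schmidt_rank_tensv _ _) n0.
Qed.

Lemma schmidt_rank_sym_ket2 n (i j : 'I_(n + n)) :
  (schmidt_rank (idOmega R (n + n) *m (ket2 i j + ket2 j i)) <= 2)%N.
Proof.
apply: leq_trans (schmidt_rank_tens_mul _ _ _) _.
apply: leq_trans (schmidt_rankD _ _) _.
exact: (leq_add (schmidt_rank_tensv _ _) (schmidt_rank_tensv _ _)).
Qed.

Lemma half_sum_sym_idOmega n :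
  1%:M + sflip R (n + n) = (2^-1)%:C *: \sum_(i < n + n) \sum_(j < n + n)
     proj (idOmega R (n + n) *m (ket2 i j + ket2 j i)).
Proof.
rewrite sum_sym_idOmega scalerA -(rmorph_nat (real_complex R)) -rmorphM.
by rewrite mulVf ?pnatr_eq0 // scale1r.
Qed.

Lemma SNcone_symplectic n : (1 < n)%N -> SNcone n (1%:M + sflip R (n + n)).
Proof.
move=> n1; rewrite half_sum_sym_idOmega; apply: SNconeZ.
  by rewrite invr_ge0.
apply: SNcone_sum => i _; apply: SNcone_sum => j _; apply: SNcone_proj.
exact: leq_trans (schmidt_rank_sym_ket2 _ _) n1.
Qed.

(** The symmetrised vector of a partner pair is exactly the Pauli Z correction of
    [SNcone_maxent_diag]. *)
Lemma idOmega_pair n (j : 'I_n) :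
  idOmega R (n + n) *m
    (ket2 (lshift n j) (rshift n j) + ket2 (rshift n j) (lshift n j)) =
  ket2 (lshift n j) (lshift n j) - ket2 (rshift n j) (rshift n j).
Proof.
rewrite mulmxDr /idOmega !tens_mul_tensv !mul1mx.
rewrite Omega_ket_rshift Omega_ket_lshift.
by congr (_ + _); apply/matrixP => p q; rewrite !mxE; ring.
Qed.

Lemma SNcone_symplectic_maxent n : (1 < n)%N ->
  SNcone n (1%:M + sflip R (n + n) + proj (maxent R (n + n))).
Proof.
move=> n1; pose S i j := proj (idOmega R (n + n) *m (ket2 i j + ket2 j i)).
pose l := @lshift n n; pose r := @rshift n n.
rewrite half_sum_sym_idOmega sum_partner scalerDr.
(* Both orders of a partner pair give the same vector, so the factor one half leaves each projection
   once. *)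
have -> : (2^-1)%:C *: \sum_(j < n) (S (l j) (r j) + S (r j) (l j)) =
    \sum_(j < n) proj (ket2 (l j) (l j) - ket2 (r j) (r j)).
  rewrite scaler_sumr; apply: eq_bigr => j _.
  rewrite /S [ket2 (r j) (l j) + _]addrC idOmega_pair.
  rewrite -mulr2n -[proj _ *+ 2]scaler_nat scalerA.
  rewrite -(rmorph_nat (real_complex R)) -rmorphM mulVf ?pnatr_eq0 //.
  exact: scale1r.
rewrite addrC addrA; apply: SNconeD; first exact: SNcone_maxent_diag.
apply: SNconeZ; first by rewrite invr_ge0.
apply: SNcone_sum => i _; apply: SNcone_sum => j _; apply: SNcone_proj.
exact: leq_trans (schmidt_rank_sym_ket2 _ _) n1.
Qed.

Lemma rho_abE d (a b : R) :
  rho_ab d a b = ((1 - a - b) / d%:R ^+ 2)%:C *: 1%:M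
    + (a / d%:R)%:C *: proj (maxent R d) + (b / d%:R)%:C *: sflip R d.
Proof.
by rewrite /rho_ab tens1mx1 proj_omega scalerA -rmorphM.
Qed.

Lemma SNcone_rho_ab n (a b : R) : (1 < n)%N ->
  a + (1 + (n + n)%:R) * b <= 1 -> (1 + (n + n)%:R) * a + b <= 1 ->
  1 <= (1 + (n + n)%:R) * (a + b) -> SNcone n (rho_ab (n + n) a b).
Proof.
move=> n1; move dE : ((n + n)%:R : R) => d hb ha hab.
have d0 : 0 < d by rewrite -dE ltr0n addn_gt0 (ltnW n1).
have dn0 : d != 0 by rewrite gt_eqF.
(* The weights solve the linear system from comparing coefficients of the identity, [proj maxent]
   and [sflip]; the three hypotheses are their nonnegativity. *)
pose al := (1 - a - b - d * b) / d ^+ 2.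
pose be := (1 - a - b - d * a) / d ^+ 2.
pose ga := (a + b + d * (a + b) - 1) / d ^+ 2.
have al0 : 0 <= al by apply: divr_ge0; [lra | exact: sqr_ge0].
have be0 : 0 <= be by apply: divr_ge0; [lra | exact: sqr_ge0].
have ga0 : 0 <= ga by apply: divr_ge0; [lra | exact: sqr_ge0].
have -> : rho_ab (n + n) a b =
    al%:C *: (1%:M + proj (maxent R (n + n)))
    + be%:C *: (1%:M + sflip R (n + n))
    + ga%:C *: (1%:M + sflip R (n + n) + proj (maxent R (n + n))).
  rewrite rho_abE dE.
  have -> : (1 - a - b) / d ^+ 2 = al + be + ga by rewrite /al /be /ga; field.
  have -> : a / d = al + ga by rewrite /al /ga; field.
  have -> : b / d = be + ga by rewrite /be /ga; field.
  rewrite !rmorphD /= !scalerDl !scalerDr.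
  move: (sflip _ _) (proj _) => M P.
  by apply/matrixP => i j; rewrite !mxE; ring.
apply: SNconeD; [apply: SNconeD|]; apply: SNconeZ => //.
- exact: SNcone_isotropic (ltnW n1).
- exact: SNcone_symplectic.
- exact: SNcone_symplectic_maxent.
Qed.

End ConeMembership.

(** * Partial transposition and the witness *)

Section PartialTranspose.
Variable R : realType.
Local Notation C := R[i].
Local Notation ket2 i j := (tensv (ket R i) (ket R j)).

Lemma ptransD m n (A B : 'M[C]_(m * n)) : ptrans (A + B) = ptrans A + ptrans B.
Proof. by apply/matrixP => p q; rewrite !mxE. Qed.

Lemma ptransZ m n c (A : 'M[C]_(m * n)) : ptrans (c *: A) = c *: ptrans A.
Proof. by apply/matrixP => p q; rewrite !mxE. Qed.

Lemma ptrans0 m n : ptrans (0 : 'M[C]_(m * n)) = 0.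
Proof. by apply/matrixP => p q; rewrite !mxE. Qed.

Lemma ptrans_sum m n (I : Type) (r : seq I) (P : pred I)
    (F : I -> 'M[C]_(m * n)) :
  ptrans (\sum_(i <- r | P i) F i) = \sum_(i <- r | P i) ptrans (F i).
Proof. exact: (big_morph (@ptrans R m n) (@ptransD m n) (@ptrans0 m n)). Qed.

Lemma ketbra_tensv m n (u u' : 'cV[C]_m) (v v' : 'cV[C]_n) :
  ketbra (tensv u v) (tensv u' v') = ketbra u u' *t ketbra v v'.
Proof.
by rewrite /ketbra adjmx_tensv; exact: (tensmx_mul u v (u'^t*) (v'^t*)).
Qed.

Lemma ketbra_ket n (i j : 'I_n) : ketbra (ket R i) (ket R j) = delta_mx i j.
Proof. by rewrite /ketbra /ket trmx_delta map_delta_mx mul_delta_mx. Qed.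

Lemma proj_maxentE d : proj (maxent R d) =
  \sum_(i < d) \sum_(j < d) (delta_mx i j *t delta_mx i j).
Proof.
rewrite /proj /ketbra /maxent adjmx_sum mulmx_suml; apply: eq_bigr => i _.
rewrite mulmx_sumr; apply: eq_bigr => j _.
by rewrite -/(ketbra _ _) ketbra_tensv ketbra_ket.
Qed.

Lemma flipE d : flip R d =
  \sum_(i < d) \sum_(j < d) (delta_mx i j *t delta_mx j i).
Proof.
apply: eq_bigr => i _; apply: eq_bigr => j _.
by rewrite ketbra_tensv !ketbra_ket.
Qed.

Lemma ptrans_maxent d : ptrans (proj (maxent R d)) = flip R d.
Proof.
rewrite proj_maxentE flipE ptrans_sum; apply: eq_bigr => i _.
rewrite ptrans_sum; apply: eq_bigr => j _.
by rewrite ptrans_tens trmx_delta.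
Qed.

(** Transposing the second factor reverses the conjugation by [Omega], but since transpose and
    adjoint of [Omega] are both [- Omega], the same conjugation reappears around the transposed unit
    matrix. *)
Lemma ptrans_sflip d : ptrans (sflip R d) =
  idOmega R d *m proj (maxent R d) *m (idOmega R d)^t*.
Proof.
rewrite /sflip flipE proj_maxentE !mulmx_sumr !mulmx_suml ptrans_sum.
apply: eq_bigr => i _; rewrite !mulmx_sumr !mulmx_suml ptrans_sum.
apply: eq_bigr => j _; rewrite adj_idOmega /idOmega !tensmx_mul ptrans_tens.
congr (_ *t _).
by rewrite !trmx_mul linearN /= trmx_Omega opprK trmx_delta mulmxA.
Qed.

Lemma idOmega_sqr n : idOmega R (n + n) *m idOmega R (n + n) = - 1%:M.
Proof.
rewrite /idOmega tensmx_mul Omega_sqr mulmx1 -(tens1mx1 R (n + n) (n + n)).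
by apply/matrixP => p q; rewrite !mxE mulrN.
Qed.

Lemma idOmega_conj_sflip n :
  idOmega R (n + n) *m sflip R (n + n) *m (idOmega R (n + n))^t* =
  flip R (n + n).
Proof.
rewrite /sflip !mulmxA idOmega_sqr mulNmx mul1mx -mulmxA -adjmxM idOmega_sqr.
by rewrite adjmxN adjmx1 mulNmx mulmxN opprK mulmx1.
Qed.

(** Partial transposition exchanges the roles of [proj maxent] and [sflip] up to conjugation by
    [idOmega], hence the swapped parameters. *)
Lemma ptrans_rho_ab n (a b : R) :
  ptrans (rho_ab (n + n) a b) =
  idOmega R (n + n) *m rho_ab (n + n) b a *m (idOmega R (n + n))^t*.
Proof.
rewrite !rho_abE !mulmxDr !mulmxDl -!scalemxAr -!scalemxAl mulmx1.
rewrite idOmega_unitary idOmega_conj_sflip !ptransD !ptransZ ptrans_maxent.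
rewrite ptrans_sflip -{1}(tens1mx1 R (n + n) (n + n)) ptrans_tens trmx1.
rewrite tens1mx1.
by rewrite [RHS]addrAC [1 - b - a]addrAC.
Qed.

(** The transpose of [proj v] is the projection onto the conjugate of [v]. *)
Lemma psd_ptrans_proj_tens m n (u : 'cV[C]_m) (v : 'cV[C]_n) :
  psd (ptrans (proj u *t proj v)).
Proof.
have -> : ptrans (proj u *t proj v) = proj (tensv u (map_mx Num.conj v)).
  rewrite ptrans_tens proj_tensv; congr (_ *t _).
  rewrite /proj /ketbra trmx_mul.
  by congr (_ *m _); apply/matrixP => i j; rewrite !mxE ?conjCK.
exact: psd_proj.
Qed.

End PartialTranspose.

(** * The Schmidt number witness *)

Section Witness.
Variable R : realType.
Local Notation C := R[i].

Lemma mxtrace_proj_unit n (x : 'cV[C]_n) : unit_vec x -> \tr (proj x) = 1.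
Proof. by move/unit_vecE => h; rewrite -[proj x]mul1mx mxtrace_proj mulmx1. Qed.

Lemma mxtrace_maxent d : \tr (proj (maxent R d)) = d%:R.
Proof.
rewrite -[proj _]mul1mx mxtrace_proj mulmx1 inner_coefmx coefmx_maxent.
by rewrite mulmx1 adjmx1 mxtrace1.
Qed.

Lemma mxtrace_flip d : \tr (flip R d) = d%:R.
Proof.
rewrite /flip linear_sum /=.
transitivity (\sum_(i < d) (1 : C)); last by rewrite sumr_const card_ord.
apply: eq_bigr => i _; rewrite linear_sum /= (bigD1 i) //= big1 ?addr0.
  by rewrite mxtrace_mulC trace_mx11 ket2_inner coefmx_ket2 mxE !eqxx.
move=> j /negbTE nj.
by rewrite mxtrace_mulC trace_mx11 ket2_inner coefmx_ket2 mxE nj.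
Qed.

Lemma mxtrace_sflip n : \tr (sflip R (n + n)) = (n + n)%:R.
Proof. by rewrite mxtrace_mulC mulmxA idOmega_unitaryV mul1mx mxtrace_flip. Qed.

(** For even [d], the weight [d - 2] bounds the rank of the coefficient matrix of (1 - M) x when x
    has Schmidt rank below d/2. *)
Definition witness d : 'M[C]_(d * d) :=
  (d%:R - 2) *: (1%:M - sflip R d) - 2 *: proj (maxent R d).

Lemma mxtrace_witness_proj d (x : 'cV[C]_(d * d)) :
  \tr (witness d *m proj x) =
  (d%:R - 2) * (x^t* *m (1%:M - sflip R d) *m x) 0 0
  - 2 * `|\tr (coefmx x)| ^+ 2.
Proof.
rewrite mxtrace_proj /witness mulmxDr mulmxN mulmxDl mulNmx.
rewrite -!scalemxAr -!scalemxAl 2!mxE; congr (_ + _).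
rewrite 2!mxE; congr (- (_ * _)).
set s := maxent R d.
(* As [coefmx s] is the identity, the two factors are [\tr (coefmx x)] and its conjugate. *)
have -> : x^t* *m proj s *m x = (x^t* *m s) *m (s^t* *m x).
  by rewrite /proj /ketbra !mulmxA.
rewrite mxE big_ord1 normCK mulrC /s.
rewrite inner_coefmx coefmx_maxent adjmx1 mul1mx; congr (_ * _).
by rewrite inner_coefmx coefmx_maxent mulmx1 mxtrace_adj.
Qed.

(* With B the coefficient matrix of (1 - M) x, M = sflip, one has
   <x|1 - M|x> = tr(B^* B) / 2, tr B = 2 tr (coefmx x), and the rank of B is at
   most twice that of x. *)
Lemma witness_ge0 n l (x : 'cV[C]_((n + n) * (n + n))) :
  (l < n)%N -> (schmidt_rank x <= l)%N ->
  0 <= \tr (witness (n + n) *m proj x).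
Proof.
move=> ln sx; rewrite mxtrace_witness_proj.
set P := 1%:M - sflip R (n + n).
have Ph : P^t* = P by rewrite /P adjmxD adjmxN adjmx1 sflip_adj.
have PP : P *m P = 2 *: P.
  rewrite /P mulmxDr mulmx1 mulmxN mulmxDl mulNmx sflipK mul1mx.
  by apply/matrixP => i j; rewrite !mxE; ring.
set X := coefmx x; pose Om := Omega R (n + n).
pose B := coefmx (P *m x).
have BE : B = X - Om *m X^T *m Om.
  by rewrite /B /P mulmxDl mulNmx mul1mx coefmxD coefmxN coefmx_sflip.
have trB : \tr B = 2 * \tr X.
  rewrite BE linearB /= mxtrace_mulC mulmxA Omega_sqr mulNmx mul1mx linearN /=.
  by rewrite mxtrace_tr; ring.
have normB : \tr (B^t* *m B) = 2 * (x^t* *m P *m x) 0 0.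
  rewrite -inner_coefmx adjmxM Ph mulmxA -(mulmxA _ P P) PP.
  by rewrite -scalemxAr -scalemxAl mxE.
have rkB : (\rank B <= l + l)%N.
  rewrite BE; apply: leq_trans (mxrank_add _ _) _; apply: leq_add => //.
  rewrite mxrank_opp; apply: leq_trans (mxrankM_maxl _ _) _.
  by apply: leq_trans (mxrankM_maxr _ _) _; rewrite mxrank_tr.
have rkB' : (\rank B)%:R <= (n + n)%:R - 2 :> C.
  rewrite lerBrDr -natrD ler_nat; apply: leq_trans (_ : l + l + 2 <= _)%N.
    by rewrite leq_add2r.
  by rewrite addn2 -addSn -addnS leq_add.
have q0 := mxtrace_adjM_ge0 B.
have := le_trans (mxtrace_rank_bound B) (ler_wpM2r q0 rkB').
rewrite trB normB normrM exprMn normr_nat -subr_ge0 => h.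
(* The rank bound is twice the claim: trace and norm of [B] contribute 4 and 2. *)
rewrite -(@pmulr_rge0 _ 2) //; move: h; congr (0 <= _); ring.
Qed.

(** Both parts vanish: [sflip] fixes the vector, and its overlap with [maxent] is the alternating
    form of [Omega] at [v], equal to its own negative by transposition. *)
Lemma witness_product n (v : 'cV[C]_(n + n)) :
  \tr (witness (n + n) *m (proj v *t proj (Omega R _ *m v))) = 0.
Proof.
rewrite -proj_tensv mxtrace_witness_proj -mulmxA mulmxDl mulNmx.
rewrite sflip_tensv_Omega mul1mx subrr mulmx0 mxE mulr0 sub0r.
have h : \tr (coefmx (tensv v (Omega R _ *m v))) = 0.
  rewrite coefmx_tensv trmx_mul trmx_Omega mulmxN mulmxN linearN /= mulmxA.
  set t := \tr _; have : t = - t.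
    rewrite {1}/t -mxtrace_tr !trmx_mul trmxK trmx_Omega mulNmx linearN /=.
    by rewrite mxtrace_mulC.
  move/eqP; rewrite -subr_eq0 opprK -mulr2n mulrn_eq0 /= => /eqP ->.
  exact: oppr0.
by rewrite h normr0 expr0n mulr0 oppr0.
Qed.

(** Follows from M P = - P, P P = d P, M M = 1 and the traces of M and P. Negativity of the value is
    the inequality of [witness_bound_cleared]. *)
Lemma mxtrace_witness_rho_ab n (a b : R) : (0 < n)%N ->
  \tr (witness (n + n) *m rho_ab (n + n) a b) =
  (((n + n)%:R - 3) - ((n + n)%:R + 1) * a
   - ((n + n)%:R + 1) * ((n + n)%:R - 3) * b)%:C.
Proof.
move=> n0; rewrite rho_abE !mulmxDr -!scalemxAr !mxtraceD !mxtraceZ mulmx1.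
set P := proj (maxent R (n + n)); set M := sflip R (n + n).
have MP : M *m P = - P.
  by rewrite /P /proj /ketbra mulmxA sflip_maxent mulNmx.
have PP : P *m P = (n + n)%:R *: P.
  rewrite {1 2}/P /proj /ketbra mulmxA -(mulmxA _ _ (maxent _ _)).
  rewrite [_^t* *m maxent _ _]mx11_scalar inner_coefmx coefmx_maxent adjmx1.
  by rewrite mulmx1 mxtrace1 mul_mx_scalar -scalemxAl.
have trP : \tr P = (n + n)%:R by exact: mxtrace_maxent.
have trM : \tr M = (n + n)%:R by exact: mxtrace_sflip.
have trPM : \tr (P *m M) = - (n + n)%:R.
  by rewrite mxtrace_mulC MP linearN /= trP.
rewrite /witness -/P -/M !mulmxDl !mulNmx -!scalemxAl !mulmxDl !mulNmx !mul1mx.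
rewrite MP PP sflipK.
rewrite !(mxtraceD, linearN, mxtraceZ) /= !mxtraceZ trM trP trPM mxtrace1 natrM.
have dC : (n + n)%:R = ((n + n)%:R : R)%:C by rewrite rmorph_nat.
have d0 : (n + n)%:R != 0 :> R by rewrite pnatr_eq0 -lt0n addn_gt0 n0.
rewrite dC; move: d0; move: ((n + n)%:R : R) => d d0; field.
by rewrite fmorph_eq0.
Qed.

End Witness.

(** * Inequalities of the parameter region and final assembly *)

Lemma witness_bound_cleared (R : realFieldType) (d a b : R) : 4 <= d ->
  a / (d - 3) + b > 1 / (d + 1) -> d - 3 < (d + 1) * (a + (d - 3) * b).
Proof.
move=> d4.
have d3 : 0 < d - 3 by lra.
have d1 : 0 < d + 1 by lra.
rewrite -(ltr_pM2r (mulr_gt0 d3 d1)).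
have -> : 1 / (d + 1) * ((d - 3) * (d + 1)) = d - 3 by field; lra.
have -> : (a / (d - 3) + b) * ((d - 3) * (d + 1)) =
          (d + 1) * (a + (d - 3) * b) by field; lra.
by [].
Qed.

(** Supplies the nonnegativity of [ga] in [SNcone_rho_ab]. Combining the two hypotheses gives 4 a >
    0; then (d - 3)(1 + d)(a + b) exceeds (d + 1)(a + (d - 3) b) by (d - 4)(d + 1) a, which is
    nonnegative. *)
Lemma parameter_region_ge1 (R : realFieldType) (d a b : R) : 4 <= d ->
  a / (d - 3) + b > 1 / (d + 1) -> a + (1 + d) * b <= 1 ->
  1 <= (1 + d) * (a + b).
Proof.
move=> d4 /(witness_bound_cleared d4) h hb.
have d3 : 0 < d - 3 by lra.
have a0 : 0 < a.
  have : (d - 3) * (a + (1 + d) * b) <= (d - 3) * 1 by rewrite ler_pM2l.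
  by lra.
have h4 : 0 <= (d - 4) * ((d + 1) * a).
  by apply: mulr_ge0; [lra | apply: mulr_ge0; lra].
by rewrite -(ler_pM2l d3); lra.
Qed.

Lemma mxtrace_rho_ab (R : realType) n (a b : R) : (0 < n)%N ->
  \tr (rho_ab (n + n) a b) = 1.
Proof.
move=> n0; rewrite rho_abE !mxtraceD !mxtraceZ mxtrace1 natrM mxtrace_maxent.
rewrite mxtrace_sflip.
have dC : (n + n)%:R = ((n + n)%:R : R)%:C by rewrite rmorph_nat.
have d0 : (n + n)%:R != 0 :> R by rewrite pnatr_eq0 -lt0n addn_gt0 n0.
rewrite dC; move: d0; move: ((n + n)%:R : R) => d d0; field.
by rewrite fmorph_eq0.
Qed.

Lemma unit_Omega (R : realType) n (v : 'cV[R[i]]_(n + n)) :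
  unit_vec v -> unit_vec (Omega R (n + n) *m v).
Proof.
rewrite /unit_vec adjmxM adj_Omega mulmxN !mulmxA mulNmx.
by rewrite -(mulmxA _ (Omega _ _)) Omega_sqr mulmxN opprK mulmx1.
Qed.

Unset Implicit Arguments.

Theorem corollary4p8 (R : realType) (d : nat) (hd4 : (4 <= d)%N)
  (hdeven : ~~ odd d) (a b : R)
  (hab : a / (d%:R - 3) + b > 1 / (d%:R + 1))
  (hab1 : a + (1 + d%:R) * b <= 1)
  (hab2 : (1 + d%:R) * a + b <= 1)
  (m : nat) (v : 'I_m -> 'cV[R[i]]_d) (hv : forall j, unit_vec (v j))
  (p : 'I_m.+1 -> R) (hp : forall j, 0 <= p j)
  (hp1 : \sum_(j < m.+1) p j = 1) (hp0 : 0 < p ord0) :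
  let rhoAB :=
    (p ord0)%:C *: rho_ab d a b
    + \sum_(j < m) (p (lift ord0 j))%:C *:
        (proj (v j) *t proj (Omega R d *m v j)) in
  is_PPT rhoAB /\ has_SN rhoAB d./2.
Proof.
have [n dE] : exists n, d = (n + n)%N.
  by exists d./2; rewrite addnn even_halfK.
subst d => rhoAB; have -> : (n + n)./2 = n by rewrite addnn doubleK.
have n1 : (1 < n)%N by rewrite -(ltn_double 1) -(addnn n) ltnW.
have n0 := ltnW n1.
have d4 : 4 <= (n + n)%:R :> R by rewrite ler_nat.
have h1 := parameter_region_ge1 d4 hab hab1.
have w0 j : 0 <= p (lift ord0 j) := hp _.
have cone : SNcone n rhoAB.
  apply: SNconeD; first by apply: SNconeZ (ltW hp0) _; exact: SNcone_rho_ab.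
  apply: SNcone_sum => j _; apply: SNconeZ => //.
  rewrite -proj_tensv; apply: SNcone_proj.
  exact: leq_trans (schmidt_rank_tensv _ _) n0.
have tr1 : \tr rhoAB = 1.
  rewrite mxtraceD mxtraceZ mxtrace_rho_ab // mulr1 linear_sum /=.
  rewrite -(rmorph1 (real_complex R)) -hp1 big_ord_recl rmorphD rmorph_sum.
  congr (_ + _); apply: eq_bigr => j _.
  rewrite mxtraceZ -proj_tensv mxtrace_proj_unit ?mulr1 //.
  exact: unit_tensv (hv j) (unit_Omega (hv j)).
split; split.
- by split; [exact: SNcone_psd cone | exact: tr1].
- rewrite ptransD ptransZ ptrans_sum; apply: psdD.
    apply: psdZ (ltW hp0) _; rewrite ptrans_rho_ab; apply: psd_conj.
    (* Cone membership is reused for its positivity, with [a] and [b] exchanged. *)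
    apply: (@SNcone_psd _ _ _ n); apply: SNcone_rho_ab => //.
    + by rewrite addrC.
    + by rewrite addrC.
    + by rewrite [b + a]addrC.
  apply: psd_sum => j _; rewrite ptransZ; apply: psdZ => //.
  exact: psd_ptrans_proj_tens.
- exact: SNcone_SN_le.
move=> l [N [w [xi [w_ge0 _ hxi rhoE]]]]; rewrite leqNgt; apply/negP => ln.
have : 0 <= \tr (witness R (n + n) *m rhoAB).
  rewrite rhoE mulmx_sumr linear_sum /=; apply: sumr_ge0 => s _.
  rewrite -scalemxAr mxtraceZ mulr_ge0 ?ler0c //.
  by have [_ sx] := hxi s; exact: witness_ge0 ln sx.
(* The product terms drop out, and since [p ord0] is positive the sign is that of the witness value
   on [rho_ab], which is negative. *)
rewrite mulmxDr -scalemxAr mxtraceD mxtraceZ mxtrace_witness_rho_ab //.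
rewrite mulmx_sumr linear_sum /= big1 ?addr0 => [|j _]; last first.
  by rewrite -scalemxAr mxtraceZ witness_product mulr0.
rewrite -rmorphM ler0c pmulr_rge0 // leNgt => /negP; apply.
by have := witness_bound_cleared d4 hab; lra.
Qed.
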